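(* Given $\varepsilon>0$, there is $\delta>0$ such that for any meaningful sampled data $\{\tilde x_t\}_{1\le t\le N}$ from an orbit $\{x_t\}_{t\ge1}$ of a nearly eventually periodic (NEP) data-driven system $\Sigma\subseteq\mathbb{C}^n$ with $N\le n$, $\mathrm{Ind}_\delta(\{\tilde x_t\})=(s,T)$ and $1\le s+T\le N-1$, and for any two matrices $A,P\in\mathbb{C}^{n\times n}$ with $\|A\|\le2$ and $P=WW^*$ for some $W\in\mathbb{C}^{n\times m}$ with $W^*W=\mathbf{1}_m$ and $m\le s+T$: if $\|A\tilde x_t-\tilde x_{t+1}\|\le\delta$ and $\|P\tilde x_t-\tilde x_t\|\le\delta$ for each $1\le t\le s+T$, then the map $\Phi:\mathbb{C}^{m\times m}\to\mathbb{C}^{n\times n}$ defined by $\Phi(Y)=WYW^*$ is multiplicative, and there is a matrix $A_\eta\in\mathbb{C}^{m\times m}$ such that $\|x_{t+1}-\Phi(A_\eta)x_t\|\le\varepsilon$ for each integer $t\ge1$. If in addition $\|PAP-A\|\le\delta$ and $\|A^{s+T+1}-A^{s+1}\|\le\delta$, then $\|A_\eta^{s+T+1}-A_\eta^{s+1}\|\le\varepsilon$.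
   Context: Vectors in $\mathbb{C}^n$ are columns, $\|\cdot\|$ is the Euclidean norm on vectors and the spectral (operator) norm on matrices, $\mathbf{1}_m$ is the $m\times m$ identity, $\hat e_{j,n}$ is the $j$-th canonical basis vector of $\mathbb{C}^n$, and $[x_1\ \cdots\ x_m]$ is the matrix with columns $x_1,\dots,x_m$. Data-driven system: a discrete-time system with state space $\Sigma\subseteq\mathbb{C}^n$ and state-transition map $\mathcal{T}$, written $\mathcal{T}_t(x)=\mathcal{T}(x,t)$; an orbit $\{x_t\}_{t\ge1}$ satisfies $\mathcal{T}_s(x_t)=x_{t+s}$. Nearly eventually periodic (NEP): an orbit $\{x_t\}_{t\ge1}\subseteq\Sigma\subseteq\mathbb{C}^n$ is NEP if for any $\varepsilon>0$ there are integers $T'\ge1$, $\tau'\ge0$ and a sequence $\{\hat x_t\}_{t\ge1}\subset\mathbb{C}^n$ with $\hat x_1\ne0$ and, for all integers $t\ge1$, $\|\hat x_t-x_t\|\le\varepsilon$ and $\hat x_{t+\tau'+T'}=\hat x_{t+\tau'}$. Orbits of a NEP system are NEP orbits. For fixed $\varepsilon>0$, the smallest integers $0\le\tau\le\tau'$ and $1\le T\le T'$ for which these relations hold form the $\varepsilon$-index $\mathrm{ind}_\varepsilon(\{x_t\})=(\tau,T)$. Generic cyclic shift: $C_{k,n}=\hat e_{k,n}\hat e_{n,n}^*+\sum_{j=1}^{n-1}\hat e_{j+1,n}\hat e_{j,n}^*\in\mathbb{C}^{n\times n}$. Sample index: for sampled data $\{\tilde x_t\}_{1\le t\le N}$ from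 an orbit and a tolerance $\gamma>0$, one writes $\mathrm{Ind}_\gamma(\{\tilde x_t\})=(s,T)$ if there exist integers $s\ge0$, $T\ge1$ such that $s+T\le N-1$ and $$\big\|[\tilde x_k\ \cdots\ \tilde x_{k+s+T-1}]\,C_{s+1,s+T}\,\hat e_{j,s+T}-\tilde x_{k+j}\big\|\le\gamma$$ for each $k=1,\dots,N-(s+T)$ and each $1\le j\le s+T$. Meaningful: given $\varepsilon>0$, the sample $\{\tilde x_t\}_{1\le t\le N}$ from $\{x_t\}_{t\ge1}$ is meaningful if $\mathrm{Ind}_\varepsilon(\{\tilde x_t\})=\mathrm{ind}_\varepsilon(\{x_t\})$, $s_0+T_0\le N-1$ for $(s_0,T_0)=\mathrm{Ind}_\varepsilon(\{\tilde x_t\})$, and $\|\tilde x_t-x_t\|\le\varepsilon$ for each $1\le t\le s_0+T_0$.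
   Formalization: ''Meaningful'' is taken with tolerance δ (the tolerance of Ind_δ) instead of ε, since with tolerance ε the claim fails (x_1=0, x_t=1.5ε e_2 for t≥2, zero sample, A=0, W=e_1); δ may depend on the fixed dimension n. *)

(* Defs.v *)
From mathcomp Require Import all_boot all_order all_algebra.
From mathcomp Require Import complex.
From mathcomp Require Import all_classical all_reals.

Set Implicit Arguments.
Unset Strict Implicit.
Unset Printing Implicit Defensive.

Import Order.TTheory GRing.Theory Num.Theory.

Local Open Scope classical_set_scope.
Local Open Scope sesquilinear_scope.
Local Open Scope complex_scope.
Local Open Scope ring_scope.

Definition vnorm (R : realType) (n : nat) (v : 'cV[R[i]]_n) : R :=
  Num.sqrt (\sum_(i < n) ComplexField.Normc.normc (v i ord0) ^+ 2).

(* The set below is nonempty and bounded above, so [sup] takes no junk value. *)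
Definition opnorm (R : realType) (p q : nat) (A : 'M[R[i]]_(p, q)) : R :=
  sup [set vnorm (A *m v) | v in [set v : 'cV[R[i]]_q | vnorm v <= 1]].

(* Sequences indexed by t >= 1 (or 1 <= t <= N) are functions on [nat] whose
   values at the other indices are never looked at. *)

(* No law relating [dds_trans] at different times is assumed; along an orbit
   such a law is part of [dds_orbit]. *)
Record dds (R : realType) (n : nat) := Dds {
  dds_state : set 'cV[R[i]]_n ;
  dds_trans : 'cV[R[i]]_n -> nat -> 'cV[R[i]]_n ;
  dds_transP : forall v t, dds_state v -> dds_state (dds_trans v t) }.

Definition dds_orbit (R : realType) (n : nat) (S : dds R n)
    (x : nat -> 'cV[R[i]]_n) : Prop :=
  forall t, (1 <= t)%N ->
    dds_state S (x t) /\ forall s, dds_trans S (x t) s = x (t + s)%N.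

(* [nep_pair eps x tau T]: x is eps-close to some sequence that is periodic of
   period T from index tau + 1 on. *)
Definition nep_pair (R : realType) (n : nat) (eps : R)
    (x : nat -> 'cV[R[i]]_n) (tau T : nat) : Prop :=
  (1 <= T)%N /\
  exists xhat : nat -> 'cV[R[i]]_n,
    xhat 1%N <> 0 /\
    forall t, (1 <= t)%N ->
      vnorm (xhat t - x t) <= eps /\ xhat (t + tau + T)%N = xhat (t + tau)%N.

Definition nep (R : realType) (n : nat) (x : nat -> 'cV[R[i]]_n) : Prop :=
  forall eps : R, 0 < eps -> exists T tau, nep_pair eps x tau T.

Definition nep_system (R : realType) (n : nat) (S : dds R n) : Prop :=
  forall x, dds_orbit S x -> nep x.

(* ind_eps(x) = (tau, T).  "Smallest" is minimality for the componentwise order: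
   a componentwise least pair need not exist, while a minimal pair exists below
   every admissible one, and a least pair, when there is one, is the only minimal
   pair. *)
Definition eps_index (R : realType) (n : nat) (eps : R)
    (x : nat -> 'cV[R[i]]_n) (tau T : nat) : Prop :=
  nep_pair eps x tau T /\
  forall tau1 T1, (tau1 <= tau)%N -> (T1 <= T)%N ->
    nep_pair eps x tau1 T1 -> tau1 = tau /\ T1 = T.

(* Canonical basis vector, j counted from 1. *)
Definition ehat (R : realType) (n j : nat) : 'cV[R[i]]_n :=
  \col_(r < n) (r.+1 == j)%:R.

Definition gcs (R : realType) (n k : nat) : 'M[R[i]]_n :=
  ehat R n k *m (ehat R n n)^t*
  + \sum_(1 <= j < n) ehat R n j.+1 *m (ehat R n j)^t*.

(* The matrix [xt_k ... xt_(k+l-1)]. *)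
Definition window (R : realType) (n : nat) (xt : nat -> 'cV[R[i]]_n)
    (k l : nat) : 'M[R[i]]_(n, l) :=
  \matrix_(r < n, c < l) xt (k + c)%N r ord0.

(* Ind_gam(xt_1, ..., xt_N) = (s, T), a relation: several pairs may qualify. *)
Definition sample_index (R : realType) (n : nat) (gam : R) (N : nat)
    (xt : nat -> 'cV[R[i]]_n) (s T : nat) : Prop :=
  (1 <= T)%N /\ (s + T <= N - 1)%N /\
  forall k j, (1 <= k <= N - (s + T))%N -> (1 <= j <= s + T)%N ->
    vnorm (window xt k (s + T) *m gcs R (s + T) s.+1 *m ehat R (s + T) j
           - xt (k + j)%N) <= gam.

Definition meaningful (R : realType) (n : nat) (eps : R) (N : nat)
    (xt x : nat -> 'cV[R[i]]_n) : Prop :=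
  exists s0 T0 : nat,
    sample_index eps N xt s0 T0 /\ eps_index eps x s0 T0 /\
    (s0 + T0 <= N - 1)%N /\
    forall t, (1 <= t <= s0 + T0)%N -> vnorm (xt t - x t) <= eps.

Definition Phi (R : realType) (n m : nat) (W : 'M[R[i]]_(n, m))
    (Y : 'M[R[i]]_m) : 'M[R[i]]_n :=
  W *m Y *m W^t*.

(* Main.v *)
Require Import Defs.
From mathcomp Require Import all_boot all_order all_algebra.
From mathcomp Require Import complex.
From mathcomp Require Import all_classical all_reals.
From mathcomp Require Import ring lra zify.

Set Implicit Arguments.
Unset Strict Implicit.
Unset Printing Implicit Defensive.

Import Order.TTheory GRing.Theory Num.Theory.

Local Open Scope sesquilinear_scope.
Local Open Scope complex_scope.
Local Open Scope ring_scope.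

(** With [Aeta = W^* A W] one has [Phi Aeta = P A P], and [Phi] does not decrease
    the operator norm.  The sampled points satisfy [A xt_j ~ xt_(j+1)] and
    [P xt_j ~ xt_j] for [j <= s + T]; the sample index says that
    [xt_j ~ xt_(j-T)] for [j > s + T], so both relations propagate to the whole
    sample with an error linear in [N <= n].  Near periodicity places every
    consecutive pair [x_t, x_(t+1)] of the orbit near a consecutive pair of the
    sample, where [P A P] acts as the time step.  The last bound compares the
    powers of [P A P] with those of [A]. *)

(** * The Euclidean norm on complex columns *)

Section EuclideanNorm.
Variable R : realType.
Implicit Types n m : nat.

Lemma adjmxM m n p (A : 'M[R[i]]_(m, n)) (B : 'M[R[i]]_(n, p)) :
  (A *m B)^t* = B^t* *m A^t*.
Proof. by rewrite trmx_mul map_mxM. Qed.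

Lemma adjmxD m n (A B : 'M[R[i]]_(m, n)) : (A + B)^t* = A^t* + B^t*.
Proof. by apply/matrixP => i j; rewrite !mxE rmorphD. Qed.

Lemma vnorm_ge0 n (v : 'cV[R[i]]_n) : 0 <= vnorm v.
Proof. exact: sqrtr_ge0. Qed.

(** Isometry and projection estimates thereby reduce to identities between the scalars [v^t* *m v],
    read in [R[i]]. *)
Lemma sqr_vnorm n (v : 'cV[R[i]]_n) : (vnorm v ^+ 2)%:C = (v^t* *m v) 0 0.
Proof.
rewrite sqr_sqrtr ?sumr_ge0 // => [|i _]; last exact: sqr_ge0.
rewrite rmorph_sum mxE; apply: eq_bigr => i _.
by rewrite !mxE -normCKC rmorphXn.
Qed.

(** The Hermitian form [dotmx] lives on row vectors, hence the transposes. The triangle inequality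
    and definiteness of [vnorm] are carried over from it. *)
Lemma vnormE n (v : 'cV[R[i]]_n) : (vnorm v)%:C = sqrtC (dotmx v^T v^T).
Proof.
rewrite dotmxE.
have -> : (v^T *m v^T^t*) 0 0 = (vnorm v ^+ 2)%:C.
  rewrite sqr_vnorm !mxE; apply: eq_bigr => i _; by rewrite !mxE mulrC.
by rewrite rmorphXn /= sqrCK // lecR; exact: vnorm_ge0.
Qed.

Lemma vnormD n (u v : 'cV[R[i]]_n) : vnorm (u + v) <= vnorm u + vnorm v.
Proof.
rewrite -lecR rmorphD /= !vnormE linearD /=.
exact: (triangle_lerif (@dotmx _ n) _ _).1.
Qed.

Lemma vnorm0 n : vnorm (0 : 'cV[R[i]]_n) = 0.
Proof.
rewrite /vnorm big1 ?sqrtr0 // => i _.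
by rewrite mxE ComplexField.Normc.normc0 expr0n.
Qed.

Lemma vnorm_eq0 n (v : 'cV[R[i]]_n) : vnorm v = 0 -> v = 0.
Proof.
move=> v0; apply: trmx_inj; apply/eqP; rewrite trmx0 -(dnorm_eq0 (@dotmx _ n)).
by rewrite -sqrtC_eq0 -vnormE v0.
Qed.

Lemma normc_ge0 (a : R[i]) : 0 <= ComplexField.Normc.normc a.
Proof. by case: a => x y; exact: sqrtr_ge0. Qed.

Lemma vnormZ n a (v : 'cV[R[i]]_n) :
  vnorm (a *: v) = ComplexField.Normc.normc a * vnorm v.
Proof.
rewrite /vnorm -[in RHS](ger0_norm (normc_ge0 a)) -sqrtr_sqr.
rewrite -sqrtrM ?sqr_ge0 // mulr_sumr; congr Num.sqrt; apply: eq_bigr => i _.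
by rewrite mxE ComplexField.Normc.normcM exprMn.
Qed.

Lemma vnormN n (v : 'cV[R[i]]_n) : vnorm (- v) = vnorm v.
Proof. by rewrite -scaleN1r vnormZ normcN ComplexField.Normc.normc1 mul1r. Qed.

Lemma vnormC n (u v : 'cV[R[i]]_n) : vnorm (u - v) = vnorm (v - u).
Proof. by rewrite -opprB vnormN. Qed.

Lemma vnorm_sub_trans n (v u w : 'cV[R[i]]_n) a b :
  vnorm (u - v) <= a -> vnorm (v - w) <= b -> vnorm (u - w) <= a + b.
Proof.
move=> ha hb; rewrite -(subrK v u) -addrA.
exact: le_trans (vnormD _ _) (lerD ha hb).
Qed.

Lemma vnorm_sum n k (F : 'I_k -> 'cV[R[i]]_n) :
  vnorm (\sum_i F i) <= \sum_i vnorm (F i).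
Proof.
elim/big_ind2: _ => [|a u b v ha hb|//]; first by rewrite vnorm0.
exact: le_trans (vnormD _ _) (lerD ha hb).
Qed.

Lemma normc_le_vnorm n (v : 'cV[R[i]]_n) i :
  ComplexField.Normc.normc (v i ord0) <= vnorm v.
Proof.
rewrite -(ger0_norm (normc_ge0 _)) -sqrtr_sqr ler_wsqrtr //.
rewrite (bigD1 i) //= lerDl sumr_ge0 // => j _; exact: sqr_ge0.
Qed.

Lemma vnorm_isometry n m (W : 'M[R[i]]_(n, m)) v :
  W^t* *m W = 1%:M -> vnorm (W *m v) = vnorm v.
Proof.
move=> hW; apply: (@pexpIrn _ 2) => //; rewrite ?nnegrE ?vnorm_ge0 //.
apply: complexI; rewrite [LHS]sqr_vnorm [RHS]sqr_vnorm adjmxM.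
by rewrite -mulmxA (mulmxA (W^t*)) hW mul1mx.
Qed.

(* Pythagoras for the orthogonal projection [W *m W^t*]. *)
Lemma vnorm_adj_isometry n m (W : 'M[R[i]]_(n, m)) v :
  W^t* *m W = 1%:M -> vnorm (W^t* *m v) <= vnorm v.
Proof.
move=> hW; rewrite -(@ler_pXn2r _ 2) ?nnegrE ?vnorm_ge0 //.
pose r := v - W *m (W^t* *m v).
suff -> : vnorm v ^+ 2 = vnorm (W^t* *m v) ^+ 2 + vnorm r ^+ 2.
  by rewrite lerDl sqr_ge0.
apply: complexI; rewrite rmorphD /= !sqr_vnorm.
have Wr : W^t* *m r = 0 by rewrite mulmxBr (mulmxA _ W) hW mul1mx subrr.
have rW : r^t* *m W = 0 by rewrite -[W]trmxCK -adjmxM Wr trmx0 map_mx0.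
have vE : v = W *m (W^t* *m v) + r by rewrite addrC subrK.
(* Only the two occurrences of [v] on the left are decomposed; the cross terms then vanish by [Wr]
   and [rW]. *)
clearbody r; rewrite {1 2}vE.
rewrite adjmxD mulmxDl !mulmxDr [in _ *m r]adjmxM.
rewrite (mulmxA (r^t*)) rW mul0mx add0r -(mulmxA _ (W^t*)) Wr mulmx0 addr0.
by rewrite adjmxM (mulmxA _ W) -(mulmxA _ _ W) hW mulmx1 mxE.
Qed.

End EuclideanNorm.

(** * The operator norm and perturbation of matrix powers *)

Section OperatorNorm.
Variable R : realType.
Implicit Types n m p q : nat.

(** Provides the upper bound that the supremum in [opnorm] requires. *)
Lemma mulmx_vnorm_bounded p q (A : 'M[R[i]]_(p, q)) :
  exists K, forall v, vnorm (A *m v) <= K * vnorm v.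
Proof.
exists (\sum_j vnorm (col j A)) => v.
have -> : A *m v = \sum_j v j ord0 *: col j A.
  apply/colP => i; rewrite summxE mxE; apply: eq_bigr => j _.
  by rewrite !mxE mulrC.
apply: le_trans (vnorm_sum _) _; rewrite mulr_suml; apply: ler_sum => j _.
by rewrite vnormZ mulrC ler_wpM2l ?vnorm_ge0 ?normc_le_vnorm.
Qed.

Lemma opnorm_le p q (A : 'M[R[i]]_(p, q)) c :
  0 <= c -> (forall v, vnorm (A *m v) <= c * vnorm v) -> opnorm A <= c.
Proof.
move=> c0 hA; apply: ge_sup.
  by exists (vnorm (A *m 0)); exists 0 => //=; rewrite vnorm0 ler01.
by move=> _ [v /= v1 <-]; apply: le_trans (hA v) _; rewrite ler_piMr.
Qed.

(** By homogeneity it is enough to treat a unit vector [u], for which [vnorm (A *m u)] is a member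
    of the set under the supremum. *)
Lemma vnorm_mulmx p q (A : 'M[R[i]]_(p, q)) v :
  vnorm (A *m v) <= opnorm A * vnorm v.
Proof.
have [K hK] := mulmx_vnorm_bounded A.
have [v0|vN0] := eqVneq (vnorm v) 0.
  by rewrite (vnorm_eq0 v0) mulmx0 !vnorm0 mulr0.
have vgt0 : 0 < vnorm v by rewrite lt_neqAle eq_sym vN0 vnorm_ge0.
have nC (a : R) : 0 <= a -> ComplexField.Normc.normc a%:C = a.
  by move=> a0 /=; rewrite expr0n addr0 sqrtr_sqr ger0_norm.
have [u u1 vE] : exists2 u, vnorm u = 1 & v = (vnorm v)%:C *: u.
  exists ((vnorm v)^-1%:C *: v).
    by rewrite vnormZ nC ?invr_ge0 ?vnorm_ge0 // mulVf.
  by rewrite scalerA -rmorphM mulfV // scale1r.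
rewrite {1}vE -scalemxAr vnormZ nC ?vnorm_ge0 // mulrC.
rewrite ler_wpM2r ?vnorm_ge0 //; apply: ub_le_sup.
  exists `|K| => _ [w /= w1 <-]; apply: le_trans (hK w) _.
  apply: le_trans (ler_wpM2r (vnorm_ge0 _) (ler_norm K)) _.
  by rewrite ler_piMr.
by exists u => //=; rewrite u1.
Qed.

Lemma opnorm_ge0 p q (A : 'M[R[i]]_(p, q)) : 0 <= opnorm A.
Proof.
have [K hK] := mulmx_vnorm_bounded A.
apply: le_trans (vnorm_ge0 (A *m 0)) _; apply: ub_le_sup.
  exists `|K| => _ [w /= w1 <-]; apply: le_trans (hK w) _.
  apply: le_trans (ler_wpM2r (vnorm_ge0 _) (ler_norm K)) _.
  by rewrite ler_piMr.
by exists 0 => //=; rewrite vnorm0 ler01.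
Qed.

Lemma vnorm_mulmx_le p q (A : 'M[R[i]]_(p, q)) v a b :
  opnorm A <= a -> vnorm v <= b -> vnorm (A *m v) <= a * b.
Proof.
move=> ha hb; apply: le_trans (vnorm_mulmx A v) _.
by apply: ler_pM; rewrite ?opnorm_ge0 ?vnorm_ge0.
Qed.

Lemma opnormD p q (A B : 'M[R[i]]_(p, q)) :
  opnorm (A + B) <= opnorm A + opnorm B.
Proof.
apply: opnorm_le => [|v]; first by rewrite addr_ge0 ?opnorm_ge0.
rewrite mulmxDl mulrDl; apply: le_trans (vnormD _ _) _.
by rewrite lerD ?vnorm_mulmx.
Qed.

Lemma opnormN p q (A : 'M[R[i]]_(p, q)) : opnorm (- A) = opnorm A.
Proof.
suff le (B : 'M[R[i]]_(p, q)) : opnorm (- B) <= opnorm B.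
  apply: le_anti; apply/andP; split; first exact: le.
  by rewrite -{1}[A]opprK; exact: le.
apply: opnorm_le => [|v]; first exact: opnorm_ge0.
by rewrite mulNmx vnormN vnorm_mulmx.
Qed.

Lemma opnormM p q m (A : 'M[R[i]]_(p, q)) (B : 'M[R[i]]_(q, m)) :
  opnorm (A *m B) <= opnorm A * opnorm B.
Proof.
apply: opnorm_le => [|v]; first by rewrite mulr_ge0 ?opnorm_ge0.
by rewrite -mulmxA -mulrA vnorm_mulmx_le ?vnorm_mulmx.
Qed.

Lemma opnormM_le p q m (A : 'M[R[i]]_(p, q)) (B : 'M[R[i]]_(q, m)) a b :
  opnorm A <= a -> opnorm B <= b -> opnorm (A *m B) <= a * b.
Proof.
move=> ha hb; apply: le_trans (opnormM A B) _.
by apply: ler_pM; rewrite ?opnorm_ge0.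
Qed.

Lemma opnorm_isometry n m (W : 'M[R[i]]_(n, m)) :
  W^t* *m W = 1%:M -> opnorm W <= 1.
Proof. by move=> hW; apply: opnorm_le => // v; rewrite vnorm_isometry ?mul1r. Qed.

Lemma opnorm_adj_isometry n m (W : 'M[R[i]]_(n, m)) :
  W^t* *m W = 1%:M -> opnorm (W^t*) <= 1.
Proof.
by move=> hW; apply: opnorm_le => // v; rewrite mul1r vnorm_adj_isometry.
Qed.

Lemma opnormX_le n (A : 'M[R[i]]_n) a k :
  opnorm A <= a -> opnorm (A ^+ k.+1) <= a ^+ k.+1.
Proof.
move=> ha; elim: k => [|k IH]; first by rewrite !expr1.
by rewrite !(exprS _ k.+1) -mulmxE opnormM_le.
Qed.

(** Telescoping: replacing one factor [A] by [B] costs at most [a ^+ k * d], and there are [k.+1]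
    factors. *)
Lemma opnormX_sub_le n (A B : 'M[R[i]]_n) a d k :
  opnorm A <= a -> opnorm B <= a -> opnorm (B - A) <= d ->
  opnorm (B ^+ k.+1 - A ^+ k.+1) <= k.+1%:R * a ^+ k * d.
Proof.
move=> hA hB hd; elim: k => [|k IH]; first by rewrite !expr1 expr0 !mul1r.
have -> : B ^+ k.+2 - A ^+ k.+2
    = B *m (B ^+ k.+1 - A ^+ k.+1) + (B - A) *m A ^+ k.+1.
  by rewrite mulmxBr mulmxBl addrA !(exprS _ k.+1) !mulmxE subrK.
apply: le_trans (opnormD _ _) _.
apply: le_trans (lerD (opnormM_le hB IH) (opnormM_le hd (opnormX_le k hA))) _.
have <- : a * (k.+1%:R * a ^+ k * d) + d * a ^+ k.+1 = k.+2%:R * a ^+ k.+1 * d.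
  by rewrite -[k.+2%:R]natr1 exprS; ring.
exact: lexx.
Qed.

End OperatorNorm.

(** * Cyclic shift, sample index and near periodicity *)

Section Sampling.
Variable R : realType.
Implicit Types n l k j s T N : nat.

(** [ehat] counts from 1 and vanishes when its index is out of range, so the diagonal case calls for
    [1 <= i <= n]. *)
Lemma ehat_dot n i j : (1 <= i <= n)%N ->
  (ehat R n i)^t* *m ehat R n j = (i == j)%:R%:M.
Proof.
case: i => [//|i] /= lt_in; apply/matrixP => a b; rewrite !ord1 !mxE.
rewrite (bigD1 (Ordinal lt_in)) //= big1 => [|r rNi].
  by rewrite !mxE /= eqxx rmorph1 mul1r addr0 mulr1n.
rewrite !mxE eqSS; case: eqP => [ri|_]; last by rewrite rmorph0 mul0r.
by case/eqP: rNi; apply: val_inj.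
Qed.

(** The last column is where the shift wraps around; in the sample index it is the one that compares
    points a period apart. *)
Lemma gcs_ehat_last l k : (1 <= l)%N -> gcs R l k *m ehat R l l = ehat R l k.
Proof.
move=> l1; rewrite /gcs mulmxDl -mulmxA ehat_dot ?l1 ?leqnn // eqxx mulmx1.
rewrite mulmx_suml big_nat big1 ?addr0 // => j /andP[j1 jl].
rewrite -mulmxA ehat_dot ?j1 ?(ltnW jl) //.
by rewrite (ltn_eqF jl) raddf0 mulmx0.
Qed.

Lemma window_ehat n (xt : nat -> 'cV[R[i]]_n) k l s : (s < l)%N ->
  window xt k l *m ehat R l s.+1 = xt (k + s)%N.
Proof.
move=> sl; apply/colP => r; rewrite mxE (bigD1 (Ordinal sl)) //= big1 => [|c cNs].
  by rewrite !mxE eqxx mulr1 addr0.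
rewrite !mxE eqSS; case: eqP => [cs|_]; last by rewrite mulr0.
by case/eqP: cNs; apply: val_inj.
Qed.

(** Case [j = s + T] of the sample index: the shift sends the last basis vector to the one of index
    [s.+1], which selects [xt (k + s)] in the window. *)
Lemma sample_index_return n gam N (xt : nat -> 'cV[R[i]]_n) s T k :
  sample_index gam N xt s T -> (1 <= k <= N - (s + T))%N ->
  vnorm (xt (k + s)%N - xt (k + (s + T))%N) <= gam.
Proof.
move=> [T1 [_ h]] hk; have sT : (1 <= s + T)%N by rewrite addn_gt0 T1 orbT.
have := h k (s + T)%N hk; rewrite sT leqnn => /(_ isT).
by rewrite -mulmxA gcs_ehat_last // window_ehat // -{1}[s]addn0 ltn_add2l.
Qed.


(* Beyond the observed window, the sample is traced back by one period at a
   time, at the cost of [3 * gam] per period. *)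
Lemma sample_index_defect n gam N (xt : nat -> 'cV[R[i]]_n) s T
    (B : 'M[R[i]]_n) e :
  0 <= gam -> sample_index gam N xt s T -> opnorm B <= 2 ->
  (forall t, (1 <= t <= s + T)%N -> vnorm (B *m xt t - xt (t + e)%N) <= gam) ->
  forall j, (1 <= j)%N -> (j + e <= N)%N ->
    vnorm (B *m xt j - xt (j + e)%N) <= (1 + 3 * j%:R) * gam.
Proof.
move=> gam0 hs hB base; elim/ltn_ind => j IH j1 jeN.
have [jle|jgt] := leqP j (s + T).
  apply: le_trans (base j _) _; first by rewrite j1.
  by rewrite mulrDl mul1r lerDl !mulr_ge0.
have [T1 _] := hs; pose i := (j - T)%N.
(* The return estimate at [k = a - (s + T)], so that [k + s = a - T]. *)
have ret a : (s + T < a)%N -> (a <= N)%N -> vnorm (xt (a - T)%N - xt a) <= gam.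
  move=> ha aN; have := @sample_index_return n gam N xt s T (a - (s + T)) hs.
  by rewrite subnK ?(ltnW ha) // => /(_ _); rewrite (_ : _ + s = a - T)%N; [apply|]; lia.
have [rj rje] : vnorm (xt i - xt j) <= gam /\
    vnorm (xt (i + e)%N - xt (j + e)%N) <= gam.
  split; first by apply: ret; lia.
  by rewrite (_ : i + e = (j + e) - T)%N; [apply: ret|]; rewrite /i; lia.
have IHi : vnorm (B *m xt i - xt (i + e)%N) <= (1 + 3 * i%:R) * gam.
  by apply: IH; lia.
have hBj : vnorm (B *m xt j - B *m xt i) <= 2 * gam.
  by rewrite -mulmxBr; apply: vnorm_mulmx_le; rewrite // vnormC.
apply: le_trans (vnorm_sub_trans (vnorm_sub_trans hBj IHi) rje) _.
(* The three errors add up to [(1 + 3 * (i + 1)) * gam], and [i + 1 <= j] because [1 <= T]. *)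
have : (i%:R + 1 : R) <= j%:R by rewrite natr1 ler_nat /i; lia.
by move=> ij; nra.
Qed.

(** Time is folded by periods into [1, ..., tau + T]; the successor of the last index folds back to
    [tau.+1]. Passing from [x] to [xhat] and back costs [eps] each way. *)
Lemma nep_pair_return n eps (x : nat -> 'cV[R[i]]_n) tau T :
  nep_pair eps x tau T ->
  forall t, (1 <= t)%N -> exists2 j, (1 <= j <= tau + T)%N &
    vnorm (x t - x j) <= eps + eps /\
    vnorm (x t.+1 - x (if j == tau + T then tau.+1 else j.+1)%N) <= eps + eps.
Proof.
move=> [T1 [xh [_ h]]].
have near a b : (1 <= a)%N -> (1 <= b)%N -> xh a = xh b ->
    vnorm (x a - x b) <= eps + eps.
  move=> /h[ha _] /h[hb _] hab; apply: (vnorm_sub_trans (v := xh a)).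
    by rewrite vnormC.
  by rewrite hab.
have per a : (tau + T < a)%N -> xh a = xh (a - T)%N.
  move=> ha; have a1 : (1 <= a - (tau + T))%N by lia.
  have [_] := h _ a1; rewrite -addnA subnK ?(ltnW ha) // => ->.
  by congr xh; lia.
(* Folding is done on [xhat], where periodicity is exact, so the error does not grow with the number
   of periods. *)
have step t : (1 <= t)%N -> exists2 j, (1 <= j <= tau + T)%N &
    xh t = xh j /\ xh t.+1 = xh j.+1.
  elim/ltn_ind: t => t IH t1; have [tle|tgt] := leqP t (tau + T).
    by exists t; rewrite ?t1.
  have [||j hj [e0 e1]] := IH (t - T)%N; [lia|lia|].
  exists j => //; rewrite -e0 -e1 -subSn; last by lia.
  by rewrite -!per //; lia.
move=> t t1; have [j hj [tj tj1]] := step t t1.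
exists j => //; split; first by apply: near => //; case/andP: hj.
apply: near => //; first by case: ifP.
rewrite tj1; case: eqP => [->|//]; rewrite per //; congr xh; lia.
Qed.

(** The pair hidden in [meaningful] may differ from another sample index of the same data. The
    conclusion therefore only places [j] and [j.+1] in the sample, which is why defects are later
    bounded on all of it. *)
Lemma meaningful_near n eps N (xt x : nat -> 'cV[R[i]]_n) :
  0 <= eps -> meaningful eps N xt x ->
  forall t, (1 <= t)%N -> exists2 j, (1 <= j < N)%N &
    vnorm (x t - xt j) <= 4 * eps /\ vnorm (x t.+1 - xt j.+1) <= 4 * eps.
Proof.
move=> eps0 [s [T [hs [[hx _] [sTN hxt]]]]] t t1.
have [T1 _] := hs.
have [j hj [tj tj1]] := nep_pair_return hx t1.
exists j; first by clear -hj T1 sTN; lia.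
have close a : (1 <= a <= s + T)%N -> vnorm (x a - xt a) <= eps.
  by move=> /hxt; rewrite vnormC.
split; first by apply: le_trans (vnorm_sub_trans tj (close j hj)) _; lra.
(* At the wrap [j = s + T] the point [x t.+1] is near [x s.+1]; the return estimate at [k = 1] leads
   from [xt s.+1] to [xt j.+1] and costs the fourth [eps]. *)
move: tj1; case: eqP => [jE|jN] tj1.
  have /close cs : (1 <= s.+1 <= s + T)%N by lia.
  have /(sample_index_return hs) : (1 <= 1 <= N - (s + T))%N by lia.
  rewrite !add1n -jE => r.
  by apply: le_trans (vnorm_sub_trans (vnorm_sub_trans tj1 cs) r) _; lra.
have /close cs : (1 <= j.+1 <= s + T)%N by lia.
by apply: le_trans (vnorm_sub_trans tj1 cs) _; lra.
Qed.

End Sampling.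

(** * The map [Phi] and compression to the range of [W] *)

Section Compression.
Variables (R : realType) (n m : nat) (W : 'M[R[i]]_(n, m)).
Hypothesis hW : W^t* *m W = 1%:M.

Lemma PhiM Y Z : Phi W (Y *m Z) = Phi W Y *m Phi W Z.
Proof.
by rewrite /Phi !mulmxA -(mulmxA _ (W^t*) W) hW mulmx1.
Qed.

(** Exponents are positive because [Phi W 1%:M] is the projection [W *m W^t*], in general not the
    identity. *)
Lemma PhiX Y k : Phi W (Y ^+ k.+1) = Phi W Y ^+ k.+1.
Proof.
elim: k => [|k IH]; first by rewrite !expr1.
by rewrite !(exprS _ k.+1) -!mulmxE PhiM IH.
Qed.

Lemma PhiB Y Z : Phi W (Y - Z) = Phi W Y - Phi W Z.
Proof. by rewrite /Phi mulmxBr mulmxBl. Qed.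

Lemma Phi_compress (A : 'M[R[i]]_n) :
  Phi W (W^t* *m A *m W) = W *m W^t* *m A *m (W *m W^t*).
Proof. by rewrite /Phi !mulmxA. Qed.

(** [Y] is recovered from [Phi W Y] by multiplying with [W^t*] and [W], both of norm at most 1. *)
Lemma opnorm_le_Phi Y : opnorm Y <= opnorm (Phi W Y).
Proof.
have YE : Y = W^t* *m (Phi W Y *m W).
  by rewrite /Phi !mulmxA hW mul1mx -mulmxA hW mulmx1.
rewrite {1}YE -[leRHS]mul1r; apply: opnormM_le.
  exact: opnorm_adj_isometry.
by rewrite -[leRHS]mulr1; apply: opnormM_le => //; exact: opnorm_isometry.
Qed.

End Compression.

(** * Error estimates for [P A P] and its powers *)

Lemma compression_step (R : realType) n (A P : 'M[R[i]]_n) x0 x1 y0 y1 c d :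
  opnorm P <= 1 -> opnorm A <= 2 ->
  vnorm (A *m y0 - y1) <= c -> vnorm (P *m y0 - y0) <= c ->
  vnorm (P *m y1 - y1) <= c -> vnorm (x0 - y0) <= d -> vnorm (x1 - y1) <= d ->
  vnorm (x1 - P *m A *m P *m x0) <= 4 * c + 3 * d.
Proof.
move=> hP hA hAy hPy0 hPy1 hx0 hx1.
(* The chain [P A P x0], [P A P y0], [P A y0], [P y1], [y1], [x1] has steps of size [2 d], [2 c],
   [c], [c], [d]. *)
have h1 : vnorm (P *m A *m P *m x0 - P *m A *m P *m y0) <= 1 * 2 * 1 * d.
  by rewrite -mulmxBr; apply: vnorm_mulmx_le; rewrite ?opnormM_le.
have h2 : vnorm (P *m A *m P *m y0 - P *m A *m y0) <= 1 * 2 * c.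
  by rewrite -mulmxA -mulmxBr vnorm_mulmx_le // opnormM_le.
have h3 : vnorm (P *m A *m y0 - P *m y1) <= 1 * c.
  by rewrite -mulmxA -mulmxBr vnorm_mulmx_le.
have h4 : vnorm (y1 - x1) <= d by rewrite vnormC.
rewrite vnormC; apply: le_trans (vnorm_sub_trans (vnorm_sub_trans
  (vnorm_sub_trans (vnorm_sub_trans h1 h2) h3) hPy1) h4) _.
by clear; lra.
Qed.

(** The comparison passes through the powers of [A]. With [1 <= a] and exponents at most [n], each
    factor [k.+1%:R * a ^+ k] is at most [n%:R * a ^+ n], a bound independent of the sample. *)
Lemma opnormX_perturb (R : realType) n (A B : 'M[R[i]]_n) a d k l :
  1 <= a -> opnorm A <= a -> opnorm B <= a -> opnorm (B - A) <= d ->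
  (k < n)%N -> (l < n)%N -> opnorm (A ^+ k.+1 - A ^+ l.+1) <= d ->
  opnorm (B ^+ k.+1 - B ^+ l.+1) <= (2 * (n%:R * a ^+ n) + 1) * d.
Proof.
move=> a1 hA hB hBA kn ln hAA.
have d0 : 0 <= d := le_trans (opnorm_ge0 _) hBA.
have a0 : 0 <= a := le_trans ler01 a1.
have pow i : (i < n)%N -> opnorm (B ^+ i.+1 - A ^+ i.+1) <= n%:R * a ^+ n * d.
  move=> lt_in; apply: le_trans (opnormX_sub_le i hA hB hBA) _.
  rewrite ler_wpM2r // ler_pM ?exprn_ge0 ?ler_nat //.
  by rewrite ler_weXn2l // ltnW.
have -> : B ^+ k.+1 - B ^+ l.+1 = (B ^+ k.+1 - A ^+ k.+1)
    + (A ^+ k.+1 - A ^+ l.+1) - (B ^+ l.+1 - A ^+ l.+1).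
  by rewrite opprB !subrKA.
apply: le_trans (opnormD _ _) _; rewrite opnormN.
apply: le_trans (lerD (le_trans (opnormD _ _) (lerD (pow k kn) hAA)) (pow l ln)) _.
by clear; lra.
Qed.

(** * Choice of [delta] and assembly of the estimates *)

Theorem theorem3p10 (R : realType) (n : nat) (eps : R) (heps : 0 < eps) :
  exists2 delta : R, 0 < delta &
  forall (S : dds R n) (x : nat -> 'cV[R[i]]_n) (N : nat)
         (xt : nat -> 'cV[R[i]]_n) (s T m : nat)
         (A P : 'M[R[i]]_n) (W : 'M[R[i]]_(n, m)),
    nep_system S -> dds_orbit S x ->
    meaningful delta N xt x ->
    (N <= n)%N ->
    sample_index delta N xt s T ->
    (1 <= s + T <= N - 1)%N ->
    opnorm A <= 2 ->
    P = W *m W^t* -> W^t* *m W = 1%:M -> (m <= s + T)%N ->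
    (forall t, (1 <= t <= s + T)%N ->
       vnorm (A *m xt t - xt t.+1) <= delta /\
       vnorm (P *m xt t - xt t) <= delta) ->
    (forall Y Z : 'M[R[i]]_m, Phi W (Y *m Z) = Phi W Y *m Phi W Z) /\
    exists Aeta : 'M[R[i]]_m,
      (forall t, (1 <= t)%N ->
         vnorm (x t.+1 - Phi W Aeta *m x t) <= eps) /\
      (opnorm (P *m A *m P - A) <= delta ->
       opnorm (A ^+ (s + T + 1) - A ^+ (s + 1)) <= delta ->
       opnorm (Aeta ^+ (s + T + 1) - Aeta ^+ (s + 1)) <= eps).
Proof.
have pos : 0 < 2 * (n%:R * 2 ^+ n) + 1 + (16 + 12 * n%:R) :> R.
  have n0 : 0 <= n%:R :> R by [].
  have : 0 <= n%:R * 2 ^+ n :> R by rewrite mulr_ge0 ?exprn_ge0.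
  lra.
(* The denominator adds the constants of both conclusions: [2 * (n * 2 ^ n) + 1] for the powers, and
   [16 + 12 n = 4 (1 + 3 n) + 3 * 4] for the orbit, from defects [(1 + 3 n) delta] and distances
   [4 delta]. *)
exists (eps / (2 * (n%:R * 2 ^+ n) + 1 + (16 + 12 * n%:R))); first by rewrite divr_gt0.
set d := eps / _ => S x N xt s T m A P W _ _ hmean leNn hs sTN hA PE hW _ hd.
have epsE : eps = (2 * (n%:R * 2 ^+ n) + 1 + (16 + 12 * n%:R)) * d.
  by rewrite mulrC divfK // gt_eqF.
have d0 : 0 <= d by rewrite divr_ge0 ?ltW.
have n0 : 0 <= n%:R :> R by [].
(* With these products as nonnegative atoms the final comparisons with [epsE] are linear. *)
have p0 : 0 <= n%:R * 2 ^+ n * d :> R by rewrite mulr_ge0 // mulr_ge0 ?exprn_ge0.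
have nd0 : 0 <= n%:R * d by rewrite mulr_ge0.
clearbody d.
have hP : opnorm P <= 1.
  rewrite PE -[leRHS]mulr1; apply: opnormM_le; first exact: opnorm_isometry.
  exact: opnorm_adj_isometry.
have bound j : (j <= n)%N -> (1 + 3 * j%:R) * d <= (1 + 3 * n%:R) * d.
  by move=> jn; rewrite ler_wpM2r // lerD2l ler_wpM2l // ler_nat.
have hAj j : (1 <= j < N)%N -> vnorm (A *m xt j - xt j.+1) <= (1 + 3 * n%:R) * d.
  case/andP=> j1 jN; apply: le_trans (bound j _); last by clear -jN leNn; lia.
  rewrite -[j.+1]addn1; apply: (sample_index_defect d0 hs) => //; last by rewrite addn1.
  by move=> t /hd[]; rewrite addn1.
have hPj j : (1 <= j <= N)%N -> vnorm (P *m xt j - xt j) <= (1 + 3 * n%:R) * d.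
  case/andP=> j1 jN; apply: le_trans (bound j _); last by clear -jN leNn; lia.
  have hP2 : opnorm P <= 2 by apply: le_trans hP _; rewrite ler1n.
  (* The projection is the case [e = 0] of the defect lemma, as the time step was the case
     [e = 1]. *)
  have hd0 t : (1 <= t <= s + T)%N -> vnorm (P *m xt t - xt (t + 0)%N) <= d.
    by rewrite addn0 => /hd[].
  by have := sample_index_defect d0 hs hP2 hd0 j1; rewrite addn0; apply.
split; first exact: PhiM.
exists (W^t* *m A *m W).
have PhiE : Phi W (W^t* *m A *m W) = P *m A *m P by rewrite Phi_compress PE.
split=> [t t1|hPAP hpow].
  have [j /andP[j1 jN] [h0 h1]] := meaningful_near d0 hmean t1.
  rewrite PhiE.
  apply: le_trans (compression_step hP hA (hAj j _) (hPj j _) (hPj j.+1 _) h0 h1) _.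
  - by rewrite j1.
  - by rewrite j1 ltnW.
  - by [].
  - by rewrite epsE; clear -d0 p0 nd0; lra.
apply: le_trans (opnorm_le_Phi hW _) _.
rewrite !addn1 in hpow *; rewrite PhiB // !PhiX // PhiE.
have hPA : opnorm (P *m A *m P) <= 2.
  by rewrite -[leRHS]mulr1 -[2]mul1r !opnormM_le.
(* Here [a = 2], [k = s + T] and [l = s]; both exponents stay below [n] since [s + T <= N - 1] and
   [N <= n]. *)
apply: le_trans (opnormX_perturb _ hA hPA hPAP _ _ hpow) _.
- by rewrite ler1n.
- by clear -sTN leNn; lia.
- by have [T1 _] := hs; clear -T1 sTN leNn; lia.
- by rewrite epsE; clear -d0 p0 nd0; lra.
Qed.
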